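(* Let $P\ge 1$, $M\ge 1$ and $1\le L\le M$ be integers. In the continue-on-completion cooperative coupon game with $P$ players, $M$ labels and lots of $L$ coupons, independently of the statistics of lot drawing (that is, for every admissible lot distribution), the average number of requested coupons (requests) is $$\mathcal{C}^{\rm req}=\frac{M}{6}\left(P^2-1\right).$$
   Context: The game. $P$ players collect coupons, each carrying one of $M$ labels; initially nobody has a coupon. Each player's local goal is to own one coupon of every label; the common goal is that all players reach their local goal. The game proceeds in bursts. In each burst a lot of $L$ coupons with pairwise different labels enters the system. Lots are drawn independently of each other and of all other random choices, from a common probability distribution on the $L$-element subsets of the label set (the lot distribution); it is admissible if every label has positive probability of belonging to a lot. The whole lot is assigned to one player, selected independently each time and uniformly among all $P$ players. That player retains the coupons of the lot whose labels she misses and offers every other (duplicate) coupon of the lot to the other players. Each player missing the label of an offered coupon issues one request for it. If there is at least one request, the coupon is assigned uniformly at random (independently for different coupons) to one of the requesting players and transferred to her; if there is no request it is discarded. In the continue-on-completion game all $P$ players remain active until the common goal is reached, even if they have completed their own collections. No new burst is started once the common goal has been achieved. $\mathcal{C}^{\rm req}$ is the expected total number of requests over the whole game until the common goal is reached; each offered coupon contributes as many requests as there are players missing its label at that moment. *)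

(* Defs.v *)
(* MathComp world (with MathComp-Analysis) *)
From mathcomp Require Import all_boot all_order all_algebra.
From mathcomp Require Import all_classical all_reals all_analysis.

Set Implicit Arguments.
Unset Strict Implicit.
Unset Printing Implicit Defensive.

Import Order.TTheory GRing.Theory Num.Theory.

Local Open Scope ring_scope.

Section LotDistribution.
Context {R : realType} {M : nat}.

Definition lot_distribution (L : nat) (mu : {set 'I_M} -> R) : Prop :=
  [/\ forall S, 0 <= mu S,
      forall S : {set 'I_M}, #|S| != L -> mu S = 0
    & \sum_(S : {set 'I_M}) mu S = 1].

Definition admissible (mu : {set 'I_M} -> R) : Prop :=
  forall l : 'I_M, 0 < \sum_(S : {set 'I_M} | l \in S) mu S.

End LotDistribution.

Section Game.
Context {R : realType} {P M : nat}.

(* [c p] is the set of labels owned by player [p]. *)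
Definition collections := {ffun 'I_P -> {set 'I_M}}.

(* [receiver b l] is the player who adds the coupon of label [l] of the lot to
   her collection: the player to whom the lot is assigned, or a requesting
   player. It is [None] if the lot has no such coupon or it is discarded. *)
Definition burst : finType :=
  ({set 'I_M} * 'I_P * {ffun 'I_M -> option 'I_P})%type.

Definition lot (b : burst) : {set 'I_M} := b.1.1.
Definition assignee (b : burst) : 'I_P := b.1.2.
Definition receiver (b : burst) : {ffun 'I_M -> option 'I_P} := b.2.

Implicit Types (c : collections) (b : burst) (l : 'I_M) (p : 'I_P).

Definition no_coupon : collections := [ffun=> finset.set0].

Definition common_goal c : bool := [forall p, c p == [set: 'I_M]].

Definition missing c l : {set 'I_P} := [set p | l \notin c p]%SET.

Definition after_burst c b : collections :=
  [ffun p => (c p :|: [set l | receiver b l == Some p])%SET].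

Definition requests c b : nat :=
  (\sum_(l in lot b | l \in c (assignee b)) #|missing c l|)%N.

(* Probability that the coupon of label [l] is received by [o], given the
   collections [c], the lot [S] and the player [p] to whom it is assigned. *)
Definition receiver_prob c (S : {set 'I_M}) p l (o : option 'I_P) : R :=
  if l \notin S then (o == None)%:R
  else if l \notin c p then (o == Some p)%:R
  else if missing c l == finset.set0 then (o == None)%:R
  else if o is Some q then (q \in missing c l)%:R / #|missing c l|%:R
  else 0.

(* The product over the labels expresses that different offered coupons are
   assigned independently. *)
Definition burst_prob (mu : {set 'I_M} -> R) c b : R :=
  mu (lot b) * P%:R^-1
  * \prod_(l : 'I_M) receiver_prob c (lot b) (assignee b) l (receiver b l).

Fixpoint play (b : nat -> burst) (n : nat) : collections :=
  if n is k.+1 then after_burst (play b k) (b k) else no_coupon.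

End Game.

Arguments collections : clear implicits.
Arguments burst : clear implicits.

Section RandomGame.
Context {R : realType} {d : measure_display} {T : measurableType d}.
Context {P M : nat}.
Local Open Scope classical_set_scope.

Definition history (B : nat -> T -> burst P M) (b : nat -> burst P M)
    (n : nat) : set T :=
  [set w | forall i, (i < n)%N -> B i w = b i].

(* The law of the [n]-th burst given all the earlier ones is prescribed as long
   as the common goal is not reached. Collections only grow, so
   [common_goal (play b n)] is false iff the goal was not reached at any time
   up to [n]. The later values of [B] stand for no burst and are arbitrary;
   [total_requests] ignores them. *)
Definition coupon_game (Pr : probability T R) (mu : {set 'I_M} -> R)
    (B : nat -> T -> burst P M) : Prop :=
  (forall n x, measurable [set w | B n w = x]) /\
  (forall n b, ~~ common_goal (play b n) ->
    Pr (history B b n.+1)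
    = (Pr (history B b n) * (burst_prob mu (play b n) (b n))%:E)%E).

Definition total_requests (B : nat -> T -> burst P M) (w : T) : \bar R :=
  (\sum_(0 <= n <oo | ~~ common_goal (play (B ^~ w) n))
     (requests (play (B ^~ w) n) (B n w))%:R%:E)%E.

Definition expected_requests (Pr : probability T R)
    (B : nat -> T -> burst P M) : \bar R :=
  (\int[Pr]_w total_requests B w)%E.

End RandomGame.

(* Main.v *)
(* Let [k] players miss the label [l]. A burst whose lot contains [l] makes
   [k] drop to [k - 1] (if [k > 0]) whoever receives the coupon, and it causes
   [k] requests with probability [1 - k / P] and none otherwise. Hence the
   expected number of requests still to come is
   [sum_l sum_(1 <= j <= k_l) j (P - j) / P], whatever the lot distribution.
   The partial sums of the expected requests telescope along this potential;
   its mean tends to 0 because it is dominated by the expected one-step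
   decrease of the total number of missing coupons, which is summable. *)
Require Import Defs.
From mathcomp Require Import all_boot all_order all_algebra.
From mathcomp Require Import all_classical all_reals all_analysis.
From mathcomp Require Import measurable_realfun.
From mathcomp Require Import ring.

Set Implicit Arguments.
Unset Strict Implicit.
Unset Printing Implicit Defensive.

Import Order.TTheory GRing.Theory Num.Theory.

Local Open Scope ring_scope.

(** * Averages over a single burst *)

Section BurstAverage.
Context {R : realType} {P M : nat}.
Implicit Types (c : collections P M) (b : burst P M) (S : {set 'I_M}).
Implicit Types (l : 'I_M) (p : 'I_P) (r : {ffun 'I_M -> option 'I_P}).

Lemma common_goalP c :
  reflect (forall l, missing c l = finset.set0) (common_goal c).
Proof.
apply: (iffP forallP) => [h l|h p].
  by apply/finset.setP => p; rewrite !inE (eqP (h p)) inE.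
apply/eqP/finset.setP => l; rewrite [in RHS]inE.
by move/finset.setP: (h l) => /(_ p); rewrite !inE => /negbFE.
Qed.

Lemma missing_after_burst c b l :
  missing (after_burst c b) l = [set p in missing c l | receiver b l != Some p]%SET.
Proof.
by apply/finset.setP => p; rewrite /missing !inE ffunE !inE negb_or.
Qed.

Lemma common_goal_after_burst c b :
  common_goal c -> common_goal (after_burst c b).
Proof.
move=> /common_goalP h; apply/common_goalP => l.
by rewrite missing_after_burst h; apply/finset.setP => p; rewrite !inE.
Qed.

Lemma sum_receiver_prob c S p l :
  \sum_o receiver_prob c S p l o = 1 :> R.
Proof.
have sum_eq (o0 : option 'I_P) : \sum_o (o == o0)%:R = 1 :> R.
  rewrite (bigD1 o0) //= eqxx big1 ?addr0 // => o /negbTE ->.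
  by [].
rewrite /receiver_prob; case: (l \notin S) => //; case: (l \notin c p) => //.
case: eqVneq => // k0; rewrite (bigD1 (None : option 'I_P)) //= add0r.
rewrite (reindex_omap Some id) /=; last by case.
rewrite (eq_bigl xpredT) => [|q]; last by rewrite eqxx.
rewrite -mulr_suml -natr_sum.
rewrite (_ : (\sum_q _)%N = #|missing c l|).
  by rewrite divff // pnatr_eq0 cards_eq0.
by rewrite -sum1_card [RHS]big_mkcond; apply: eq_bigr => q _; case: ifP.
Qed.

(** A nonzero probability forces the receiver to be a player missing the label whenever there is
    one. If nobody misses it the coupon is discarded and the truncated subtraction stays at 0. *)
Lemma card_missing_after_burst c b l :
  receiver_prob c (lot b) (assignee b) l (receiver b l) != 0 :> R ->
  #|missing (after_burst c b) l| = (#|missing c l| - (l \in lot b))%N.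
Proof.
rewrite /receiver_prob missing_after_burst.
have none : receiver b l = None ->
    [set p in missing c l | receiver b l != Some p]%SET = missing c l.
  by move=> ->; apply/finset.setP => p; rewrite !inE andbT.
have some q : receiver b l = Some q -> q \in missing c l ->
    #|[set p in missing c l | receiver b l != Some p]%SET|
    = (#|missing c l| - 1)%N.
  move=> -> qm; rewrite [in RHS](cardsD1 q) qm add1n subn1 /=.
  apply: eq_card => p; rewrite !inE andbC; congr (~~ _ && _).
  exact: eq_sym.
case: ifPn => [lS|/negbNE lS].
  case: (receiver b l =P None) => [/none -> _|_]; last by rewrite eqxx.
  by rewrite (negbTE lS) subn0.
rewrite lS; case: ifPn => [lp|_].
  case: (receiver b l =P Some (assignee b)) => [|_]; last by rewrite eqxx.
  by move=> /some -> //; rewrite inE.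
case: ifPn => [/eqP m0|_].
  case: (receiver b l =P None) => [/none -> _|_]; last by rewrite eqxx.
  by rewrite m0 cards0.
case E : (receiver b l) => [q|]; last by rewrite eqxx.
rewrite -E; case qm : (q \in missing c l); last by rewrite mul0r eqxx.
by rewrite (some _ E qm).
Qed.

(** [F] ignores the receivers, so they can be summed out: the sum over receiver functions of a
    product over labels is a product of sums, each equal to 1. *)
Lemma sum_burst_prob (mu : {set 'I_M} -> R) c (F : {set 'I_M} -> 'I_P -> R) :
  \sum_b burst_prob mu c b * F (lot b) (assignee b)
  = \sum_S mu S * \sum_p P%:R^-1 * F S p.
Proof.
rewrite (eq_bigr (fun b => mu (lot b) * P%:R^-1 * F (lot b) (assignee b) *
  \prod_l receiver_prob c (lot b) (assignee b) l (receiver b l))); last first.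
  by move=> b _; rewrite /burst_prob mulrAC.
rewrite -(pair_bigA _ (fun sp (r : {ffun 'I_M -> option 'I_P}) => mu sp.1 * P%:R^-1 * F sp.1 sp.2 *
  \prod_l receiver_prob c sp.1 sp.2 l (r l))) /=.
rewrite -(pair_bigA _ (fun S p =>
  \sum_(r : {ffun 'I_M -> option 'I_P}) mu S * P%:R^-1 * F S p *
  \prod_l receiver_prob c S p l (r l))) /=.
apply: eq_bigr => S _; rewrite mulr_sumr; apply: eq_bigr => p _.
rewrite -mulr_sumr -bigA_distr_bigA big1 ?mulr1 ?mulrA // => l _.
exact: sum_receiver_prob.
Qed.

(* Whoever receives the coupon, a burst whose lot contains [l] lowers the
   number of players missing [l] by exactly one, unless it is already zero. *)
Lemma sum_burst_prob_missing (mu : {set 'I_M} -> R) c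
    (u : 'I_M -> nat -> R) (hP : (0 < P)%N) :
  \sum_b burst_prob mu c b * \sum_l u l #|missing (after_burst c b) l|
  = \sum_S mu S * \sum_l u l (#|missing c l| - (l \in S))%N.
Proof.
rewrite (eq_bigr (fun b => burst_prob mu c b *
    \sum_l u l (#|missing c l| - (l \in lot b))%N)); last first.
  move=> b _; have [->|bp0] := eqVneq (burst_prob mu c b) 0; first by rewrite !mul0r.
  congr (_ * _); apply: eq_bigr => l _; rewrite card_missing_after_burst //.
  move: bp0; rewrite /burst_prob mulf_eq0 negb_or => /andP[_].
  by move=> /prodf_neq0 /(_ l isT).
rewrite (sum_burst_prob _ _ (fun S _ => \sum_l u l (#|missing c l| - (l \in S))%N)).
apply: eq_bigr => S _; rewrite sumr_const card_ord.
rewrite -[X in _ * X]mulr_natr mulrAC mulVf ?mul1r //.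
by rewrite pnatr_eq0 -lt0n.
Qed.

Lemma card_owners c l : #|[pred p | l \in c p]| = (P - #|missing c l|)%N.
Proof.
rewrite -[X in (X - _)%N]card_ord -(cardC (mem (missing c l))) addKn.
by apply: eq_card => p; rewrite !inE negbK.
Qed.

(** A coupon is offered exactly when its assignee already owns the label; with [k] players missing
    it, this holds for [P - k] of the [P] equally likely assignees. *)
Lemma sum_burst_prob_requests (mu : {set 'I_M} -> R) c :
  \sum_b burst_prob mu c b * (requests c b)%:R
  = \sum_S mu S * \sum_(l in S)
      (#|missing c l|%:R * (P%:R - #|missing c l|%:R) / P%:R).
Proof.
rewrite (sum_burst_prob _ _
  (fun S p => (\sum_(l in S | l \in c p) #|missing c l|)%:R)).
apply: eq_bigr => S _; congr (_ * _); rewrite -mulr_sumr.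
under eq_bigr do rewrite natr_sum big_mkcondr.
rewrite exchange_big /= mulr_sumr; apply: eq_bigr => l _.
rewrite -big_mkcond sumr_const card_owners -[X in _ * X]mulr_natr natrB.
  by rewrite mulrC.
by rewrite -[leqRHS]card_ord max_card.
Qed.

End BurstAverage.

(** * The potential of a label and its closed form *)

Section Potential.
Context {R : realType} {P M : nat}.
Implicit Types (c : collections P M) (l : 'I_M) (k : nat).

(* Expected number of requests for a coupon whose label [k] players miss:
   [k] of them with probability [1 - k / P], none otherwise. *)
Definition label_cost k : R := k%:R * (P%:R - k%:R) / P%:R.

(** The number of players missing a label passes once through each level from [k] down to 1; the
    shift [j.+1] omits level 0. *)
Definition label_potential k : R := \sum_(j < k) label_cost j.+1.

Definition potential c : R := \sum_l label_potential #|missing c l|.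

Lemma label_cost_ge0 k : (k <= P)%N -> 0 <= label_cost k.
Proof.
by move=> kP; rewrite divr_ge0 ?mulr_ge0 // subr_ge0 ler_nat.
Qed.

Lemma label_potentialS k :
  label_potential k.+1 = label_potential k + label_cost k.+1.
Proof. exact: big_ord_recr. Qed.

(** One-step balance for one label, [b] telling whether the lot contains it. At [k = 0] the cost
    vanishes and the subtraction truncates. *)
Lemma label_potential_sub k (b : bool) :
  b%:R * label_cost k + label_potential (k - b) = label_potential k.
Proof.
case: b k => [] [|k]; rewrite ?subn0 ?mul0r ?add0r //.
  by rewrite /label_cost !mul0r mulr0 add0r.
by rewrite subn1 label_potentialS mul1r addrC.
Qed.

Lemma label_potential_ge0 k : (k <= P)%N -> 0 <= label_potential k.
Proof.
move=> kP; apply: sumr_ge0 => j _; apply: label_cost_ge0.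
exact: leq_trans (ltn_ord j) kP.
Qed.

(** Compares the potential with the indicator that someone still misses the label, the quantity that
    governs the decrease of the missing coupons. *)
Lemma label_potential_le k :
  (k <= P)%N -> label_potential k <= label_potential P * (0 < k)%:R.
Proof.
case: k => [|k] kP; first by rewrite mulr0 /label_potential big_ord0.
rewrite mulr1 /label_potential (big_ord_widen P (label_cost \o succn)) //.
rewrite big_mkcond; apply: ler_sum => j _ /=; case: ifP => // _.
exact: label_cost_ge0.
Qed.

Lemma label_potential_players (hP : (0 < P)%N) :
  label_potential P = (P%:R ^+ 2 - 1) / 6.
Proof.
have P0 : P%:R != 0 :> R by rewrite pnatr_eq0 -lt0n.
(* Multiplying by [P] clears the denominator of [label_cost]; the two terms come from the sums of
   [j] and of [j ^ 2] up to [k]. *)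
have closed k : P%:R * label_potential k
    = P%:R * (k%:R * (k%:R + 1)) / 2 - k%:R * (k%:R + 1) * (2 * k%:R + 1) / 6.
  elim: k => [|k IH]; first by rewrite /label_potential big_ord0; ring.
  rewrite label_potentialS mulrDr IH /label_cost -natr1.
  by field.
apply: (mulfI P0); rewrite closed; by field.
Qed.

End Potential.

Arguments label_cost {R} P k.
Arguments label_potential {R} P k.

(** * One-step drift of the potential and of the missing coupons *)

Section PotentialDrift.
Context {R : realType} {P M : nat}.
Variables (mu : {set 'I_M} -> R) (hP : (0 < P)%N).
Hypothesis mu_sum1 : \sum_S mu S = 1.
Implicit Types (c : collections P M) (l : 'I_M) (k : nat).

Lemma card_missing_le c l : (#|missing c l| <= P)%N.
Proof. by rewrite -[leqRHS]card_ord max_card. Qed.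

Lemma potential_ge0 c : 0 <= potential c :> R.
Proof. by apply: sumr_ge0 => l _; rewrite label_potential_ge0 ?card_missing_le. Qed.

Lemma potential_common_goal c : common_goal c -> potential c = 0 :> R.
Proof.
move=> /common_goalP h; apply: big1 => l _.
by rewrite h cards0 /label_potential big_ord0.
Qed.

Lemma potential_no_coupon :
  potential (no_coupon : collections P M) = M%:R / 6 * (P%:R ^+ 2 - 1) :> R.
Proof.
have m l : missing (no_coupon : collections P M) l = [set: 'I_P]%SET.
  by apply/finset.setP => p; rewrite !inE ffunE inE.
rewrite /potential; under eq_bigr do rewrite m cardsT card_ord.
rewrite sumr_const card_ord label_potential_players // -[LHS]mulr_natr.
by ring.
Qed.

Lemma requests_common_goal c b : common_goal c -> requests c b = 0%N.
Proof. by move=> /common_goalP h; apply: big1 => l _; rewrite h cards0. Qed.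

(** The balance holds label by label for every fixed lot, by [label_potential_sub]; averaging over
    lots uses only the total mass 1 of [mu], hence the independence of the lot statistics. *)
Lemma potential_drift c :
  \sum_b burst_prob mu c b * (requests c b)%:R
    + \sum_b burst_prob mu c b * potential (after_burst c b) = potential c.
Proof.
rewrite sum_burst_prob_requests (sum_burst_prob_missing _ _ (fun=> label_potential P)) //.
rewrite -big_split /= -[RHS]mul1r -[X in _ = X * _]mu_sum1 mulr_suml; apply: eq_bigr => S _.
rewrite -mulrDr [X in X + _]big_mkcond -big_split /=; congr (_ * _).
apply: eq_bigr => l _; rewrite -[RHS](label_potential_sub _ (l \in S)).
by case: (l \in S); rewrite ?mul1r ?mul0r.
Qed.

(** A second Lyapunov function: its mean decreases add up to at most its initial value. *)
Definition missing_coupons c : nat := (\sum_l #|missing c l|)%N.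

Lemma missing_coupons_common_goal c : common_goal c -> missing_coupons c = 0%N.
Proof. by move=> /common_goalP h; apply: big1 => l _; rewrite h cards0. Qed.

Lemma missing_coupons_drift c :
  \sum_b burst_prob mu c b * (missing_coupons (after_burst c b))%:R
    + \sum_l (\sum_(S : {set 'I_M} | l \in S) mu S) * (0 < #|missing c l|)%:R
  = (missing_coupons c)%:R.
Proof.
under eq_bigr do rewrite natr_sum.
rewrite (sum_burst_prob_missing _ _ (fun _ k => k%:R)) //.
rewrite natr_sum -[RHS]mul1r -[X in _ = X * _]mu_sum1 mulr_suml.
under [X in _ + X]eq_bigr do rewrite mulr_suml big_mkcond.
rewrite exchange_big -big_split /=; apply: eq_bigr => S _.
rewrite !mulr_sumr -big_split /=; apply: eq_bigr => l _.
case: (l \in S); last by rewrite subn0 addr0.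
by rewrite -mulrDr; case: #|_| => [|k]; rewrite ?addr0 // subn1 /= natr1.
Qed.

(** Admissibility enters here: each label still missing is hit by the lot with a positive
    probability, by which one can divide. *)
Lemma potential_le_drift (hadm : admissible mu) :
  exists2 K : R, 0 <= K & forall c, potential c <=
    K * \sum_l (\sum_(S : {set 'I_M} | l \in S) mu S) * (0 < #|missing c l|)%:R.
Proof.
pose q l := \sum_(S : {set 'I_M} | l \in S) mu S.
have vP0 : 0 <= label_potential P P :> R by exact: label_potential_ge0.
(* The sum over labels serves as a common upper bound of the constants needed for the individual
   labels. *)
exists (\sum_l label_potential P P / q l) => [|c].
  by apply: sumr_ge0 => l _; rewrite divr_ge0 // ltW // hadm.
rewrite mulr_sumr; apply: ler_sum => l _.
apply: le_trans (label_potential_le (card_missing_le c l)) _.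
rewrite mulrA ler_wpM2r // -ler_pdivrMr ?hadm //.
rewrite (bigD1 l) //= lerDl; apply: sumr_ge0 => i _.
by rewrite divr_ge0 // ltW // hadm.
Qed.

End PotentialDrift.

(** * Random variables with finitely many values *)

Section FiniteValued.
Context {R : realType} {d : measure_display} {T : measurableType d}.
Context (Pr : probability T R) (F : finType) (Y : T -> F).
Local Open Scope classical_set_scope.
Hypothesis mY : forall y, measurable [set w | Y w = y].

Lemma probability_partition (A : set T) : measurable A ->
  Pr A = (\sum_y Pr (A `&` [set w | Y w = y]))%E.
Proof.
move=> mA; have mAY y : measurable (A `&` [set w | Y w = y]) by exact: measurableI.
rewrite -[A in LHS]setIT -integral_indic //.
under eq_integral => w _.
  rewrite (_ : (\1_A w)%:E
    = (\sum_y (\1_(A `&` [set w | Y w = y]) w)%:E)%E); first over.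
  rewrite (bigD1 (Y w)) //= big1 ?adde0 => [|y /eqP yY].
    by rewrite !indicE in_setI [X in _ && X]mem_set ?andbT.
  by rewrite indicE in_setI [X in _ && X]memNset ?andbF // => /esym.
rewrite ge0_integral_sum // => [|y].
  by apply: eq_bigr => y _; rewrite integral_indic // setIT.
exact/measurable_EFinP.
Qed.

Lemma ge0_integral_finite_valued (g : F -> R) : (forall y, 0 <= g y) ->
  (\int[Pr]_w (g (Y w))%:E = \sum_y (g y)%:E * Pr [set w | Y w = y])%E.
Proof.
move=> g0.
under eq_integral => w _.
  rewrite (_ : (g (Y w))%:E
    = (\sum_y (g y)%:E * (\1_[set w | Y w = y] w)%:E)%E); first over.
  rewrite (bigD1 (Y w)) //= big1 ?adde0 => [|y /eqP yY].
    by rewrite indicE mem_set // mule1.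
  by rewrite indicE memNset ?mule0 // => /esym.
rewrite ge0_integral_sum //.
- apply: eq_bigr => y _; rewrite ge0_integralZl_EFin //.
    by rewrite integral_indic // setIT.
  exact/measurable_EFinP.
- by move=> y; apply/measurable_EFinP; apply: measurable_funM.
- by move=> y w _; rewrite mule_ge0 // lee_fin.
Qed.

Lemma measurable_finite_valued (g : F -> \bar R) :
  measurable_fun setT (fun w => g (Y w)).
Proof.
move=> _ A mA; rewrite setTI.
rewrite (_ : _ @^-1` _ = \bigcup_(y in [set y | A (g y)]) [set w | Y w = y]).
  by apply: fin_bigcup_measurable => // y _; exact: mY.
by apply/seteqP; split=> [w Aw|w [y Ay /= ->]] //; exists (Y w).
Qed.

End FiniteValued.

(** * Markov property and means along the game *)

Section Law.
Context {R : realType} {d : measure_display} {T : measurableType d}.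
Context {P M : nat}.
Variables (Pr : probability T R) (mu : {set 'I_M} -> R).
Variables (B : nat -> T -> burst P M) (hB : coupon_game Pr mu B).
Implicit Types (c : collections P M) (n : nat).
Local Open Scope classical_set_scope.

Lemma eq_play n (b b' : nat -> burst P M) :
  (forall i, (i < n)%N -> b i = b' i) -> play b n = play b' n.
Proof.
elim: n => //= n IH h; rewrite h // IH // => i ni.
by rewrite h // (ltn_trans ni).
Qed.

(** The pair makes the induction work: the next collections are a function of it, so their level
    sets are finite unions of earlier ones. *)
Lemma measurable_play_burst n y :
  measurable [set w | (play (B ^~ w) n, B n w) = y].
Proof.
elim: n y => [|n IH] [c b].
  have [->|cN] := eqVneq c no_coupon.
    rewrite (_ : [set _ | _] = [set w | B 0%N w = b]); first exact: hB.1.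
    by apply/seteqP; split=> w /= [] // ->.
  rewrite (_ : [set _ | _] = set0) //.
  by apply/seteqP; split=> w //= [] /esym /eqP; rewrite (negbTE cN).
rewrite (_ : [set _ | _] =
    (\bigcup_(y in [set y | after_burst y.1 y.2 = c])
       [set w | (play (B ^~ w) n, B n w) = y])
    `&` [set w | B n.+1 w = b]).
  apply: measurableI; last exact: hB.1.
  by apply: fin_bigcup_measurable => [|y _]; [exact: finite_finset|exact: IH].
apply/seteqP; split=> w /=.
  by case=> <- <-; split=> //; exists (play (B ^~ w) n, B n w).
by case=> -[y /= <- <-] <-.
Qed.

Lemma measurable_play n c : measurable [set w | play (B ^~ w) n = c].
Proof.
rewrite (_ : [set _ | _] = \bigcup_(b in [set: burst P M])
    [set w | (play (B ^~ w) n, B n w) = (c, b)]).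
  by apply: fin_bigcup_measurable => // b _; exact: measurable_play_burst.
by apply/seteqP; split=> w /= [] => [<-|b _ [->]] //; exists (B n w).
Qed.

(** Indexes the histories of length [n] by a finite type, so that total probability applies to
    them. *)
Lemma historyP n (h : n.-tuple (burst P M)) b w :
  history B (nth b h) n w <-> [tuple B i w | i < n] = h.
Proof.
split=> [H|<- i ni].
  by apply: eq_from_tnth => i; rewrite tnth_mktuple H // -tnth_nth.
by rewrite -[i]/(nat_of_ord (Ordinal ni)) -tnth_nth tnth_mktuple.
Qed.

Lemma measurable_history n (h : n.-tuple (burst P M)) :
  measurable [set w | [tuple B i w | i < n] = h].
Proof.
rewrite (_ : [set _ | _] = \bigcap_(i in [set: 'I_n]) [set w | B i w = tnth h i]).
  by apply: fin_bigcap_measurable => // i _; exact: hB.1.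
apply/seteqP; split=> w /= => [<- i _|H] /=.
  by rewrite tnth_mktuple.
by apply: eq_from_tnth => i; rewrite tnth_mktuple H.
Qed.

(** Markov property: the prescribed law depends on the history only through the current collections,
    so one sums over all histories leading to [c]. *)
Lemma play_burst_law n c b : ~~ common_goal c ->
  Pr [set w | (play (B ^~ w) n, B n w) = (c, b)]
  = (Pr [set w | play (B ^~ w) n = c] * (burst_prob mu c b)%:E)%E.
Proof.
move=> cN.
have mh := @measurable_history n.
rewrite (probability_partition Pr mh (measurable_play_burst n (c, b))).
rewrite (probability_partition Pr mh (measurable_play n c)).
rewrite ge0_sume_distrl //; apply: eq_bigr => h _.
have playE w : [tuple B i w | i < n] = h -> play (B ^~ w) n = play (nth b h) n.
  by move=> /(historyP h b); exact: eq_play.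
have [hc|hc] := eqVneq (play (nth b h) n) c.
  (* At index [n] the sequence [nth b h] takes its default value [b], so this history also
     prescribes the burst [n]. *)
  transitivity (Pr (history B (nth b h) n.+1)).
    congr (Pr _); apply/seteqP; split=> w /=.
      case=> -[_ Bb] /(historyP h b) wh i; rewrite ltnS leq_eqVlt.
      by move=> /orP[/eqP ->|/wh //]; rewrite nth_default // size_tuple.
    move=> H; have wh : [tuple B i w | i < n] = h.
      by apply/(historyP h b) => i ni; apply: H; exact: ltnW.
    split=> //; rewrite playE // hc; congr (_, _).
    by rewrite H // nth_default // size_tuple.
  rewrite hB.2 ?hc // nth_default ?size_tuple //; congr (Pr _ * _)%E.
  apply/seteqP; split=> w /= => [/(historyP h b) wh|[_ /(historyP h b)//]].
  by rewrite playE.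
(* A history that does not lead to [c] contributes 0 on both sides. *)
rewrite [X in Pr X = _](_ : _ = set0) ?[X in (Pr X * _)%E](_ : _ = set0).
- by rewrite measure0 mul0e.
- apply/seteqP; split=> w //= [wc /playE]; rewrite wc => /esym /eqP.
  by rewrite (negbTE hc).
- apply/seteqP; split=> w //= [[wc _] /playE]; rewrite wc => /esym /eqP.
  by rewrite (negbTE hc).
Qed.

Definition play_mean n (f : collections P M -> R) : R :=
  \sum_c fine (Pr [set w | play (B ^~ w) n = c]) * f c.

Lemma play_mean_ge0 n f : (forall c, 0 <= f c) -> 0 <= play_mean n f.
Proof. by move=> f0; apply: sumr_ge0 => c _; rewrite mulr_ge0 // fine_ge0. Qed.

Lemma play_meanD n f g :
  play_mean n (fun c => f c + g c) = play_mean n f + play_mean n g.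
Proof. by rewrite -big_split; apply: eq_bigr => c _; rewrite mulrDr. Qed.

Lemma play_mean_le n f g :
  (forall c, f c <= g c) -> play_mean n f <= play_mean n g.
Proof. by move=> fg; apply: ler_sum => c _; rewrite ler_wpM2l ?fine_ge0. Qed.

Lemma play_meanZ n a f : play_mean n (fun c => a * f c) = a * play_mean n f.
Proof. by rewrite mulr_sumr; apply: eq_bigr => c _; rewrite mulrCA. Qed.

Lemma integral_play n f : (forall c, 0 <= f c) ->
  (\int[Pr]_w (f (play (B ^~ w) n))%:E = (play_mean n f)%:E)%E.
Proof.
move=> f0; rewrite (ge0_integral_finite_valued Pr (measurable_play n)) //.
rewrite -sumEFin; apply: eq_bigr => c _.
rewrite EFinM fineK; first exact: muleC.
by rewrite fin_num_measure //; exact: measurable_play.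
Qed.

Lemma play_mean0 f : (forall c, 0 <= f c) -> play_mean 0 f = f no_coupon.
Proof.
move=> f0; apply: EFin_inj; rewrite -integral_play //=.
by rewrite integral_cst // [X in (_ * X)%E](@probability_setT _ _ _ Pr) mule1.
Qed.

(** The law of a burst is unspecified once the goal is reached; there [g] vanishes. *)
Lemma integral_play_burst n (g : collections P M -> burst P M -> R) :
  (forall c b, 0 <= g c b) -> (forall c b, common_goal c -> g c b = 0) ->
  (\int[Pr]_w (g (play (B ^~ w) n) (B n w))%:E
   = (play_mean n (fun c => \sum_b burst_prob mu c b * g c b))%:E)%E.
Proof.
move=> g0 gN.
rewrite (ge0_integral_finite_valued Pr (measurable_play_burst n)
  (g := fun y => g y.1 y.2)) //.
transitivity (\sum_c \sum_b (g c b)%:E *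
    Pr [set w | (play (B ^~ w) n, B n w) = (c, b)])%E.
  by rewrite pair_bigA; apply: eq_bigr => -[].
rewrite -sumEFin; apply: eq_bigr => c _.
rewrite mulr_sumr -sumEFin; apply: eq_bigr => b _.
have [cN|cN] := boolP (common_goal c); first by rewrite gN // !mulr0 mul0e.
rewrite play_burst_law // !EFinM fineK; first by rewrite muleC -muleA.
by rewrite fin_num_measure //; exact: measurable_play.
Qed.

Lemma play_meanS n f :
  (forall c, 0 <= f c) -> (forall c, common_goal c -> f c = 0) ->
  play_mean n.+1 f
  = play_mean n (fun c => \sum_b burst_prob mu c b * f (after_burst c b)).
Proof.
move=> f0 fN; apply: EFin_inj; rewrite -integral_play //.
rewrite (@integral_play_burst n (fun c b => f (after_burst c b))) // => c b cN.
by rewrite fN // common_goal_after_burst.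
Qed.

End Law.

(** * Telescoping and passage to the limit *)

Theorem theorem3 (R : realType) (P M L : nat)
  (hP : (1 <= P)%N) (hM : (1 <= M)%N) (hL1 : (1 <= L)%N) (hLM : (L <= M)%N)
  (mu : {set 'I_M} -> R) (hmu : lot_distribution L mu) (hadm : admissible mu)
  (d : measure_display) (T : measurableType d) (Pr : probability T R)
  (B : nat -> T -> burst P M) (hB : coupon_game Pr mu B) :
  expected_requests Pr B = (M%:R / 6 * (P%:R ^+ 2 - 1))%:E.
Proof.
have [mu_ge0 _ mu_sum1] := hmu.
pose V : collections P M -> R := @potential R P M.
pose W : collections P M -> R := fun c => (missing_coupons c)%:R.
pose mean n (f : collections P M -> R) := play_mean Pr B n f.
pose r (c : collections P M) : R := \sum_b burst_prob mu c b * (requests c b)%:R.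
have V0 c : 0 <= V c by exact: potential_ge0.
have W0 c : 0 <= W c by rewrite /W.
have V_step n : mean n r + mean n.+1 V = mean n V.
  rewrite /mean (play_meanS hB) //; last exact: potential_common_goal.
  rewrite -play_meanD; apply: eq_bigr => c _.
  by rewrite potential_drift.
have [K K0 VK] := potential_le_drift (P := P) hadm.
have V_le n : mean n V <= K * (mean n W - mean n.+1 W).
  rewrite /mean (play_meanS hB n W0) => [|c /missing_coupons_common_goal]; last first.
    by rewrite /W => ->.
  rewrite -[X in _ <= K * (_ - X)]mul1r -mulNr -play_meanZ -play_meanD -play_meanZ.
  apply: play_mean_le => c; apply: le_trans (VK c) _.
  rewrite ler_wpM2l // mulN1r lerBrDl.
  by rewrite (missing_coupons_drift hP mu_sum1).
(* The series of the nonnegative terms [mean n V] has partial sums at most [K * mean 0 W], since the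
   bounds [V_le] telescope; so its terms tend to 0. *)
have V_cvg0 : (mean n V @[n --> \oo] --> 0)%classic.
  apply: cvg_series_cvg_0; apply: nondecreasing_is_cvgn.
    apply/nondecreasing_seqP => n; rewrite /series /= big_nat_recr //= lerDl.
    exact: play_mean_ge0.
  exists (K * mean 0 W) => _ [n _ <-].
  apply: (@le_trans _ _ (K * (mean 0%N W - mean n W))).
    elim: n => [|n IH]; first by rewrite /series /= big_nil subrr mulr0.
    rewrite /series /= big_nat_recr //=; apply: le_trans (lerD IH (V_le n)) _.
    by rewrite -mulrDr addrA subrK.
  by rewrite ler_wpM2l // gerBl play_mean_ge0.
have r_sum n : \sum_(0 <= i < n) mean i r = mean 0%N V - mean n V.
  elim: n => [|n IH]; first by rewrite big_nil subrr.
  by rewrite big_nat_recr //= IH -(V_step n); ring.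
rewrite /expected_requests /total_requests.
under eq_integral => w _.
  rewrite eseries_mkcond (eq_eseriesr (g := fun n =>
    (requests (play (B ^~ w) n) (B n w))%:R%:E)); first over.
  by move=> n _; case: ifPn => // /negbNE/requests_common_goal ->.
rewrite integral_nneseries //; last first.
  move=> n; exact: (measurable_finite_valued (measurable_play_burst hB n)
    (fun y => (requests y.1 y.2)%:R%:E)).
rewrite (eq_eseriesr (g := fun n => (mean n r)%:E)) => [|n _]; last first.
  rewrite (integral_play_burst hB n (g := fun c b => (requests c b)%:R)) //.
  by move=> c b /requests_common_goal ->.
(* The claimed value is the potential of the empty collections, which is [mean 0 V], the limit of
   the partial sums in [r_sum]. *)
rewrite -(potential_no_coupon (M := M) hP) -[potential _]/(V _).
rewrite -(play_mean0 hB V0).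
apply/cvg_lim => //; under eq_fun do rewrite sumEFin r_sum.
apply: cvg_EFin; first exact: nearW.
rewrite -[X in (_ --> X)%classic]subr0.
by apply: cvgB => //; exact: cvg_cst.
Qed.
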